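(* Let $X\in\mathbf{Ar}$, let $B$ be an integrable cone and let $f_1,f_2\in\mathbf{ICones}(\mathcal{M}(X),B)$. If $f_1(\delta_r)=f_2(\delta_r)$ for all $r\in X$, where $\delta_r$ is the Dirac measure at $r$, then $f_1=f_2$.
   Context: Cones. A precone is a module $P$ over $\mathbb{R}_{\ge 0}$ with $x_1+x=x_2+x\Rightarrow x_1=x_2$ and $x_1+x_2=0\Rightarrow x_1=0$, ordered by $x\le y$ iff $y=x+z$ for some $z$. A cone is a precone with $\|\cdot\|:P\to\mathbb{R}_{\ge0}$ such that $\|\lambda x\|=\lambda\|x\|$, $\|x\|=0\Rightarrow x=0$, $\|x+y\|\le\|x\|+\|y\|$, $\|x\|\le\|x+y\|$, and every increasing sequence in $\mathcal{B}P=\{x:\|x\|\le 1\}$ has a lub in $P$ lying in $\mathcal{B}P$. Continuous = monotone and preserving lubs of norm-bounded increasing sequences; $\|f\|=\sup_{x\in\mathcal{B}P}\|f(x)\|$; $P'$ = cone of linear continuous maps $P\to\mathbb{R}_{\ge0}$. Measurability. Fix a small full subcategory $\mathbf{Ar}$ of measurable spaces, closed under binary products, containing the one-point space $0$, with non-empty objects. A measurability structure on $P$ is a family $(\mathcal{M}_X)_{X\in\mathbf{Ar}}$ of sets of maps $m:X\times P\to\mathbb{R}_{\ge0}$ with $m(r,\cdot)\in P'$ such that: (i) $r\mapsto m(r,x)$ measurable into $[0,1]$ for $x\in\mathcal{B}P$; (ii) $(s,x)\mapsto m(\phi(s),x)\in\mathcal{M}_Y$ for $\phi\in\mathbf{Ar}(Y,X)$;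 (iii) $\mathcal{M}_0$ separates points; (iv) $\|x\|=\sup\{m(x)/\|m\|:m\in\mathcal{M}_0\setminus\{0\}\}$. Paths of arity $X$: bounded $\gamma:X\to C$ with $(s,r)\mapsto m(s,\gamma(r))$ measurable for all $m\in\mathcal{M}_Y$. Integral over finite $\mu$: the $x$ with $m(x)=\int m(\gamma(r))\mu(dr)$ for all $m\in\mathcal{M}_0$. Integrable cone: all such integrals exist. $\mathbf{ICones}$: integrable cones with linear, continuous, norm $\le1$, measurable (paths to paths), integral-preserving maps. $\mathcal{M}(X)$: the integrable cone of finite measures on $X$, pointwise operations, norm $\mu(X)$, tests $(s,\mu)\mapsto\mu(U)$ for $U$ measurable in $X$. *)

(* Defs.v *)
From HB Require Import structures.
From mathcomp Require Import all_boot all_order all_algebra.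
From mathcomp Require Import all_classical all_reals all_analysis.
From mathcomp Require Import measurable_realfun.

Set Implicit Arguments.
Unset Strict Implicit.
Unset Printing Implicit Defensive.

Import Order.TTheory GRing.Theory Num.Theory.

Local Open Scope classical_set_scope.
Local Open Scope ring_scope.

Section nonneg_semiring.
Variable R : realType.
Implicit Types x y z : {nonneg R}.

Let add x y : {nonneg R} := (x%:num + y%:num)%:nng.
Let mul x y : {nonneg R} := (x%:num * y%:num)%:nng.

Let addA : associative add.
Proof. by move=> x y z; apply/val_inj; rewrite /= addrA. Qed.

Let addC : commutative add.
Proof. by move=> x y; apply/val_inj; rewrite /= addrC. Qed.

Let add0 : left_id (0%:nng : {nonneg R}) add.
Proof. by move=> x; apply/val_inj; rewrite /= add0r. Qed.

HB.instance Definition _ := Choice.on {nonneg R}.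

HB.instance Definition _ := GRing.isNmodule.Build {nonneg R} addA addC add0.

Let mulA : associative mul.
Proof. by move=> x y z; apply/val_inj; rewrite /= mulrA. Qed.

Let mulC : commutative mul.
Proof. by move=> x y; apply/val_inj; rewrite /= mulrC. Qed.

Let mul1 : left_id (1%:nng : {nonneg R}) mul.
Proof. by move=> x; apply/val_inj; rewrite /= mul1r. Qed.

Let mulDl : left_distributive mul +%R.
Proof. by move=> x y z; apply/val_inj; rewrite /= mulrDl. Qed.

Let mul0 : left_zero (0 : {nonneg R}) mul.
Proof. by move=> x; apply/val_inj; rewrite /= mul0r. Qed.

Let one_neq0 : (1%:nng : {nonneg R}) != 0.
Proof. by rewrite -(inj_eq val_inj) /= oner_eq0. Qed.

HB.instance Definition _ := GRing.Nmodule_isComNzSemiRing.Build {nonneg R}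
  mulA mulC mul1 mulDl mul0 one_neq0.

End nonneg_semiring.

Section nonneg_lemmas.
Variable R : realType.

Lemma nonnegDE (x y : {nonneg R}) : (x + y)%:num = x%:num + y%:num.
Proof. by []. Qed.

End nonneg_lemmas.

HB.mixin Record isPrecone (R : realType) P of GRing.LSemiModule {nonneg R} P := {
  precone_addIr : forall x x1 x2 : P, x1 + x = x2 + x -> x1 = x2;
  precone_addr_eq0 : forall x1 x2 : P, x1 + x2 = 0 -> x1 = 0
}.

#[short(type="preconeType")]
HB.structure Definition Precone (R : realType) :=
  {P of GRing.LSemiModule {nonneg R} P & isPrecone R P}.

Section precone_order.
Variables (R : realType) (P : preconeType R).
Implicit Types (x y : P) (u : nat -> P).

Definition cone_le x y := exists z, y = x + z.

Definition cone_increasing u := {homo u : n m / (n <= m)%N >-> cone_le n m}.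

Definition cone_lub u x :=
  (forall n, cone_le (u n) x) /\
  (forall y, (forall n, cone_le (u n) y) -> cone_le x y).

Lemma cone_le_refl x : cone_le x x.
Proof. by exists 0; rewrite addr0. Qed.

Lemma cone_le_trans y x z : cone_le x y -> cone_le y z -> cone_le x z.
Proof. by move=> [a ->] [b ->]; exists (a + b); rewrite addrA. Qed.

Lemma cone_le_anti x y : cone_le x y -> cone_le y x -> x = y.
Proof.
move=> [a ->] [b /esym]; rewrite -addrA => xabE.
suff /precone_addr_eq0 -> : a + b = 0 by rewrite addr0.
by apply: (@precone_addIr _ _ x); rewrite add0r addrC.
Qed.

Lemma cone_lub_unique u x y : cone_lub u x -> cone_lub u y -> x = y.
Proof. by move=> [ux xu] [uy yu]; apply: cone_le_anti; [exact: xu|exact: yu]. Qed.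

End precone_order.

HB.mixin Record isCone (R : realType) P of Precone R P := {
  cone_norm : P -> R;
  cone_norm_ge0 : forall x, 0 <= cone_norm x;
  cone_normZ : forall (a : {nonneg R}) x, cone_norm (a *: x) = a%:num * cone_norm x;
  cone_norm0_eq0 : forall x, cone_norm x = 0 -> x = 0;
  cone_normD : forall x y, cone_norm (x + y) <= cone_norm x + cone_norm y;
  cone_norm_mono : forall x y, cone_norm x <= cone_norm (x + y);
  cone_complete : forall u : nat -> P, cone_increasing u ->
    (forall n, cone_norm (u n) <= 1) ->
    exists2 x, cone_lub u x & cone_norm x <= 1
}.

#[short(type="coneType")]
HB.structure Definition Cone (R : realType) := {P of Precone R P & isCone R P}.

Section cone_maps.
Variables (R : realType) (P Q : coneType R).
Implicit Type f : P -> Q.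

Definition cone_linear f :=
  {morph f : x y / x + y} /\ (forall (a : {nonneg R}) x, f (a *: x) = a *: f x).

Definition cone_continuous f :=
  {homo f : x y / cone_le x y} /\
  (forall u : nat -> P, cone_increasing u ->
     (exists M, forall n, cone_norm (u n) <= M) ->
     forall x, cone_lub u x -> cone_lub (f \o u) (f x)).

(* Extended real; it is finite when f is linear and continuous. *)
Definition cone_opnorm f : \bar R :=
  ereal_sup [set (cone_norm (f x))%:E | x in [set x | cone_norm x <= 1]].

End cone_maps.

Section nonneg_cone.
Variable R : realType.
Local Notation Rnng := ({nonneg R}^o).
Implicit Types x y : Rnng.

Let addIr x x1 x2 : x1 + x = x2 + x -> x1 = x2.
Proof.
by move=> /(congr1 (fun z : Rnng => z%:num)) /= /addIr ?; exact/val_inj.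
Qed.

Let addr_eq0 x1 x2 : x1 + x2 = 0 -> x1 = 0.
Proof.
move=> /(congr1 (fun z : Rnng => z%:num)) /= /eqP.
by rewrite paddr_eq0// => /andP[/eqP x10 _]; exact/val_inj.
Qed.

HB.instance Definition _ := isPrecone.Build R Rnng addIr addr_eq0.

Lemma nonneg_cone_leP x y : cone_le x y <-> x%:num <= y%:num.
Proof.
split=> [[z ->]|xy]; first by rewrite nonnegDE lerDl.
have yx0 : 0 <= y%:num - x%:num by rewrite subr_ge0.
by exists (NngNum yx0); apply/val_inj => /=; rewrite addrC subrK.
Qed.

Lemma nonneg_cone_lubP (u : nat -> Rnng) x :
  cone_lub u x <-> ((forall n, (u n)%:num <= x%:num) /\
    forall y : R, (forall n, (u n)%:num <= y) -> x%:num <= y).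
Proof.
split=> [[ux xu]|[ux xu]]; split.
- by move=> n; exact/nonneg_cone_leP.
- move=> y uy.
  have y0 : 0 <= y by exact: le_trans (uy 0%N).
  have /xu/nonneg_cone_leP// : forall n, cone_le (u n) (NngNum y0 : Rnng).
  by move=> n; apply/nonneg_cone_leP; exact: uy.
- by move=> n; exact/nonneg_cone_leP.
- by move=> y uy; apply/nonneg_cone_leP/xu => n; exact/nonneg_cone_leP.
Qed.

Let norm x : R := x%:num.

Let complete (u : nat -> Rnng) : cone_increasing u ->
  (forall n, norm (u n) <= 1) -> exists2 x, cone_lub u x & norm x <= 1.
Proof.
move=> _ u1; pose A := range (fun n => (u n)%:num).
have A1 : ubound A 1 by move=> _ [n _ <-]; exact: u1.
have supA : has_sup A by split; [exists (u 0%N)%:num, 0%N|exists 1].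
have uA n : (u n)%:num <= sup A by apply: ub_le_sup; [exists 1|exists n].
have A0 : 0 <= sup A by exact: le_trans (uA 0%N).
exists (NngNum A0 : Rnng); last by apply: ge_sup => //; case: supA.
apply/nonneg_cone_lubP; split=> // y uy.
by apply: ge_sup; [case: supA|move=> _ [n _ <-]].
Qed.

Let norm_ge0 x : 0 <= norm x. Proof. by rewrite /norm. Qed.

Let normZ (a : {nonneg R}) x : norm (a *: x) = a%:num * norm x.
Proof. by []. Qed.

Let norm0_eq0 x : norm x = 0 -> x = 0.
Proof. by move=> x0; exact/val_inj. Qed.

Let normD x y : norm (x + y) <= norm x + norm y.
Proof. exact: lexx. Qed.

Let norm_mono x y : norm x <= norm (x + y).
Proof. by rewrite /norm nonnegDE lerDl. Qed.

HB.instance Definition _ := isCone.Build R Rnng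
  norm_ge0 normZ norm0_eq0 normD norm_mono complete.

End nonneg_cone.

(* A small full subcategory of measurable spaces: its objects are indexed by a
   type and its morphisms are all the measurable functions. A measurableType is
   pointed, hence non-empty. Closure under products is up to isomorphism. *)
Record arCat := ArCat {
  ar_obj :> Type;
  ar_display : ar_obj -> measure_display;
  ar_space : forall X : ar_obj, measurableType (ar_display X);
  ar_one : ar_obj;
  ar_pt : ar_space ar_one;
  ar_one_unique : forall s : ar_space ar_one, s = ar_pt;
  ar_prod_closed : forall X Y : ar_obj, exists (Z : ar_obj)
    (f : ar_space Z -> ar_space X * ar_space Y)
    (g : ar_space X * ar_space Y -> ar_space Z),
    [/\ measurable_fun setT f, measurable_fun setT g, cancel f g & cancel g f]
}.

Definition cone_dual (R : realType) (P : coneType R) : set (P -> {nonneg R}^o) :=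
  [set f | cone_linear f /\ cone_continuous f].

Definition cone_test (R : realType) (Ar : arCat) (P : Type) (X : Ar) :=
  ar_space X -> P -> {nonneg R}^o.

HB.mixin Record isMeasurableCone (R : realType) (Ar : arCat) P of Cone R P := {
  cone_tests : forall X : Ar, set (cone_test R P X);
  cone_tests_dual : forall (X : Ar) m, cone_tests X m ->
    forall r, cone_dual (m r);
  cone_tests_measurable : forall (X : Ar) m, cone_tests X m ->
    forall x : P, cone_norm x <= 1 ->
    measurable_fun setT (fun r => (m r x)%:num) /\ forall r, (m r x)%:num <= 1;
  cone_tests_comp : forall (X Y : Ar) (phi : ar_space Y -> ar_space X),
    measurable_fun setT phi ->
    forall m, cone_tests X m -> cone_tests Y (fun s => m (phi s));
  cone_tests_separate : forall x1 x2 : P,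
    (forall m, cone_tests (ar_one Ar) m -> m (ar_pt Ar) x1 = m (ar_pt Ar) x2) ->
    x1 = x2;
  (* sup set0 = 0 in R, as for suprema in the nonnegative reals *)
  cone_tests_norm : forall x : P, cone_norm x =
    sup [set (m (ar_pt Ar) x)%:num / fine (cone_opnorm (m (ar_pt Ar))) | m in
         [set m | cone_tests (ar_one Ar) m /\ m (ar_pt Ar) <> cst 0]]
}.

#[short(type="mconeType")]
HB.structure Definition MeasurableCone (R : realType) (Ar : arCat) :=
  {P of Cone R P & isMeasurableCone R Ar P}.

Section paths.
Variables (R : realType) (Ar : arCat) (P : mconeType R Ar) (X : Ar).
Implicit Types (gamma : ar_space X -> P) (x : P).

Definition cone_path gamma :=
  (exists M, forall r, cone_norm (gamma r) <= M) /\
  (forall (Y : Ar) (m : cone_test R P Y), cone_tests Y m ->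
     measurable_fun setT (fun sr : ar_space Y * ar_space X =>
       (m sr.1 (gamma sr.2))%:num)).

Definition cone_integral gamma (mu : {finite_measure set (ar_space X) -> \bar R}) x :=
  forall m : cone_test R P (ar_one Ar), cone_tests (ar_one Ar) m ->
    ((m (ar_pt Ar) x)%:num)%:E = (\int[mu]_r ((m (ar_pt Ar) (gamma r))%:num)%:E)%E.

End paths.

HB.mixin Record isIntegrableCone (R : realType) (Ar : arCat) P
    of MeasurableCone R Ar P := {
  cone_integrable : forall (X : Ar) (gamma : ar_space X -> P), cone_path gamma ->
    forall mu : {finite_measure set (ar_space X) -> \bar R},
    exists x, cone_integral gamma mu x
}.

#[short(type="iconeType")]
HB.structure Definition IntegrableCone (R : realType) (Ar : arCat) :=
  {P of MeasurableCone R Ar P & isIntegrableCone R Ar P}.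

Record icone_morphism (R : realType) (Ar : arCat) (P Q : iconeType R Ar)
    (f : P -> Q) : Prop := IconeMorphism {
  icone_linear : cone_linear f;
  icone_continuous : cone_continuous f;
  icone_norm_le1 : (cone_opnorm f <= 1)%E;
  icone_measurable : forall (X : Ar) (gamma : ar_space X -> P),
    cone_path gamma -> cone_path (f \o gamma);
  icone_integral : forall (X : Ar) (gamma : ar_space X -> P), cone_path gamma ->
    forall (mu : {finite_measure set (ar_space X) -> \bar R}) x,
    cone_integral gamma mu x -> cone_integral (f \o gamma) mu (f x)
}.

Record ICones (R : realType) (Ar : arCat) (P Q : iconeType R Ar) := ICone {
  icone_fun :> P -> Q;
  icone_funP : icone_morphism icone_fun
}.

Lemma icone_ext (R : realType) (Ar : arCat) (P Q : iconeType R Ar)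
  (f g : ICones P Q) : f =1 g -> f = g.
Proof.
case: f g => [f fP] [g gP] /= /funext fg; rewrite fg in fP *.
by congr ICone; exact: Prop_irrelevance.
Qed.

(* A mathcomp measure is a function on all subsets and is unconstrained outside
   the sigma-algebra; requiring it to vanish there makes Leibniz equality
   coincide with equality of measures. *)
Record finmeas (R : realType) d (T : measurableType d) := FinMeas {
  finmeas_val :> {finite_measure set T -> \bar R};
  finmeas_out : forall U, ~ measurable U -> finmeas_val U = 0%E
}.

Section finmeas_ext.
Context (R : realType) d (T : measurableType d).
Local Open Scope ereal_scope.

Lemma finmeas_ext (mu nu : finmeas R T) :
  (forall U, measurable U -> mu U = nu U) -> mu = nu.
Proof.
case: mu nu => [mu mu0] [nu nu0] /= munu.
have {}munu : mu = nu :> (set T -> \bar R).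
  apply/funext => U; have [mU|mU] := pselect (measurable U); first exact: munu.
  by rewrite mu0// nu0.
have {}munu : mu = nu.
  case: mu nu munu {mu0 nu0} => f [[a1 a2] [b1] [c1] [e1] [h1]].
  move=> [g [[a1' a2'] [b1'] [c1'] [e1'] [h1']]] /= fg; subst g.
  have -> : a1' = a1 by [].
  have -> : a2' = a2 by [].
  have -> : b1' = b1 by [].
  have -> : c1' = c1 by [].
  have -> : e1' = e1 by [].
  by have -> : h1' = h1 by [].
by rewrite munu in mu0 *; congr FinMeas; exact: Prop_irrelevance.
Qed.

Section trunc.
Variables (mu : {measure set T -> \bar R}) (mufin : fin_num_fun mu).

Definition mtrunc (_ : fin_num_fun mu) (U : set T) : \bar R :=
  if `[< measurable U >] then mu U else 0.

Local Notation tmu := (mtrunc mufin).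

Let mtruncE U : measurable U -> tmu U = mu U.
Proof. by rewrite /mtrunc; case: asboolP. Qed.

Let mtrunc0 : tmu set0 = 0. Proof. by rewrite mtruncE. Qed.

Let mtrunc_ge0 U : 0 <= tmu U. Proof. by rewrite /mtrunc; case: asboolP. Qed.

Let mtrunc_sigma_additive : semi_sigma_additive tmu.
Proof.
move=> F mF tF mUF; rewrite mtruncE//.
under eq_fun do under eq_bigr do rewrite mtruncE//.
exact: measure_semi_sigma_additive.
Qed.

HB.instance Definition _ := isMeasure.Build _ _ _ tmu
  mtrunc0 mtrunc_ge0 mtrunc_sigma_additive.

Let mtrunc_fin : fin_num_fun tmu.
Proof. by move=> U mU; rewrite mtruncE// mufin. Qed.

HB.instance Definition _ := @Measure_isFinite.Build _ _ _ tmu mtrunc_fin.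

Let mtrunc_out U : ~ measurable U -> tmu U = 0.
Proof. by rewrite /mtrunc; case: asboolP. Qed.

Definition finmeas_of : finmeas R T := @FinMeas R d T tmu mtrunc_out.

Lemma finmeas_ofE U : measurable U -> finmeas_of U = mu U.
Proof. exact: mtruncE. Qed.

End trunc.

Definition finmeas_dirac (r : T) : finmeas R T :=
  @finmeas_of (\d_r) (fin_num_measure (\d_r : {finite_measure set T -> \bar R})).

Lemma finmeas_diracE r U : measurable U -> finmeas_dirac r U = \d_r U.
Proof. exact: finmeas_ofE. Qed.

End finmeas_ext.
Arguments finmeas_of {R d T} mu mufin.
Arguments finmeas_dirac {R d T} r.

HB.instance Definition _ (R : realType) d (T : measurableType d) :=
  gen_eqMixin (finmeas R T).
HB.instance Definition _ (R : realType) d (T : measurableType d) :=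
  gen_choiceMixin (finmeas R T).

Section finmeas_module.
Context (R : realType) d (T : measurableType d).
Local Open Scope ereal_scope.
Implicit Types mu nu : finmeas R T.

Let zero_fin : fin_num_fun (@mzero d T R). Proof. by []. Qed.

Let zero : finmeas R T := finmeas_of mzero zero_fin.

Let add_fin mu nu : fin_num_fun (measure_add mu nu).
Proof.
by move=> U mU; rewrite measure_addE fin_numD !fin_num_measure.
Qed.

Let add mu nu : finmeas R T := finmeas_of (measure_add mu nu) (@add_fin mu nu).

Let addE mu nu U : measurable U -> add mu nu U = mu U + nu U.
Proof. by move=> mU; rewrite finmeas_ofE//; exact: measure_addE. Qed.

Let addA : associative add.
Proof. by move=> x y z; apply: finmeas_ext => U mU; rewrite !addE// addeA. Qed.

Let addC : commutative add.
Proof. by move=> x y; apply: finmeas_ext => U mU; rewrite !addE// addeC. Qed.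

Let add0 : left_id zero add.
Proof.
by move=> x; apply: finmeas_ext => U mU; rewrite addE// finmeas_ofE// add0e.
Qed.

HB.instance Definition _ := GRing.isNmodule.Build (finmeas R T) addA addC add0.

Lemma finmeas0E U : measurable U -> (0%R : finmeas R T) U = 0.
Proof. by move=> mU; rewrite [LHS]finmeas_ofE. Qed.

Lemma finmeasDE mu nu U : measurable U -> (mu + nu)%R U = mu U + nu U.
Proof. exact: addE. Qed.

Let scale_fin (a : {nonneg R}) mu : fin_num_fun (mscale a mu).
Proof. by move=> U mU; rewrite fin_numM// fin_num_measure. Qed.

Let scale (a : {nonneg R}) mu : finmeas R T :=
  finmeas_of (mscale a mu) (@scale_fin a mu).

Let scaleE a mu U : measurable U -> scale a mu U = a%:num%:E * mu U.
Proof. exact: finmeas_ofE. Qed.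

Let scaleA a b mu : scale a (scale b mu) = scale (a * b)%R mu.
Proof. by apply: finmeas_ext => U mU; rewrite !scaleE// EFinM muleA. Qed.

Let scale0 mu : scale 0%R mu = 0%R.
Proof. by apply: finmeas_ext => U mU; rewrite scaleE// finmeas0E// mul0e. Qed.

Let scale1 : left_id 1%R scale.
Proof. by move=> mu; apply: finmeas_ext => U mU; rewrite scaleE// mul1e. Qed.

Let scaleDr : right_distributive scale +%R.
Proof.
move=> a mu nu; apply: finmeas_ext => U mU.
by rewrite finmeasDE// !scaleE// finmeasDE// ge0_muleDr.
Qed.

Let scaleDl mu : {morph scale^~ mu : a b / (a + b)%R}.
Proof.
move=> a b; apply: finmeas_ext => U mU.
by rewrite finmeasDE// !scaleE// EFinD ge0_muleDl.
Qed.

HB.instance Definition _ := GRing.Nmodule_isLSemiModule.Build {nonneg R}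
  (finmeas R T) scaleA scale0 scale1 scaleDr scaleDl.

Lemma finmeasZE a mu U : measurable U -> (a *: mu)%R U = a%:num%:E * mu U.
Proof. exact: scaleE. Qed.

Let addIr (x x1 x2 : finmeas R T) : (x1 + x = x2 + x -> x1 = x2)%R.
Proof.
move=> x12; apply: finmeas_ext => U mU.
have := congr1 (fun z : finmeas R T => z U - x U) x12.
by rewrite !finmeasDE// !addeK// fin_num_measure.
Qed.

Let addr_eq0 (x1 x2 : finmeas R T) : (x1 + x2 = 0 -> x1 = 0)%R.
Proof.
move=> x12; apply: finmeas_ext => U mU; rewrite finmeas0E//.
have := congr1 (fun z : finmeas R T => z U) x12.
rewrite finmeasDE// finmeas0E// => /eqP.
by rewrite padde_eq0// => /andP[/eqP].
Qed.

HB.instance Definition _ := isPrecone.Build R (finmeas R T) addIr addr_eq0.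

Lemma finmeas_leP mu nu :
  cone_le mu nu <-> forall U, measurable U -> mu U <= nu U.
Proof.
split=> [[z ->] U mU|munu]; first by rewrite finmeasDE// leeDl.
pose cmu := charge_of_finite_measure mu.
pose cnu := charge_of_finite_measure nu.
pose c := cadd cnu (cscale (-1) cmu).
have cE U : c U = nu U - mu U.
  by rewrite /c /cadd /= /cscale EFinN mulN1e.
have c0 U : 0 <= c U.
  rewrite cE; have [mU|mU] := pselect (measurable U).
    by rewrite sube_ge0 ?munu// fin_num_measure.
  by rewrite !finmeas_out// sube0.
have cfin : fin_num_fun (measure_of_charge c c0).
  by move=> U mU; rewrite /measure_of_charge cE fin_numB !fin_num_measure.
exists (finmeas_of (measure_of_charge c c0) cfin).
apply: finmeas_ext => U mU; rewrite finmeasDE//.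
have -> : finmeas_of (measure_of_charge c c0) cfin U = c U by exact: finmeas_ofE.
by rewrite cE addeC subeK// fin_num_measure.
Qed.

Definition finmeas_eval mu U : {nonneg R} := NngNum (fine_ge0 (measure_ge0 mu U)).

Lemma finmeas_evalE mu U : measurable U -> ((finmeas_eval mu U)%:num)%:E = mu U.
Proof. by move=> mU; rewrite /finmeas_eval /= fineK// fin_num_measure. Qed.

Lemma finmeas_lub (u : nat -> finmeas R T) : cone_increasing u ->
  (exists M : R, forall n, u n setT <= M%:E) ->
  exists2 x, cone_lub u x &
    forall U, measurable U -> u ^~ U @ \oo --> x U.
Proof.
move=> uinc [M uM].
have /choice[z zE] : forall n, exists z, u n.+1 = (u n + z)%R.
  by move=> n; exact: uinc.
pose nu : {measure set T -> \bar R} := measure_add (u 0%N) (mseries z 0).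
have uE n U : measurable U -> u n U = u 0%N U + \sum_(0 <= k < n) z k U.
  move=> mU; elim: n => [|n ih]; first by rewrite big_nil adde0.
  by rewrite zE finmeasDE// ih big_nat_recr//= addeA.
have nuE U : nu U = u 0%N U + \sum_(0 <= k <oo) z k U by exact: measure_addE.
have nucvg U : measurable U -> u ^~ U @ \oo --> nu U.
  move=> mU; rewrite nuE.
  under eq_fun do rewrite uE//.
  apply: cvgeD => //.
  - apply: ge0_adde_def => //; rewrite inE//.
    by apply: nneseries_ge0.
  - exact: cvg_cst.
  - by apply: is_cvg_nneseries.
have undec U : measurable U -> nondecreasing_seq (u ^~ U).
  by move=> mU n m nm; have /finmeas_leP := uinc _ _ nm; exact.
have nuT : nu setT <= M%:E.
  apply: (@cvge_le _ \oo _ _ (u ^~ setT)) ; last exact: nucvg.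
  by apply: nearW.
have nufin : fin_num_fun nu.
  move=> U mU; rewrite ge0_fin_numE//; apply: le_lt_trans (ltry M).
  by apply: le_trans nuT; apply: le_measure; rewrite ?inE.
exists (finmeas_of nu nufin); last first.
  by move=> U mU; rewrite finmeas_ofE//; exact: nucvg.
split.
  move=> n; apply/finmeas_leP => U mU; rewrite finmeas_ofE//.
  apply: (@cvge_ge _ \oo _ _ (u ^~ U)) (nucvg _ mU); near=> m.
  by apply: undec => //; near: m; exact: nbhs_infty_ge.
move=> y uy; apply/finmeas_leP => U mU; rewrite finmeas_ofE//.
apply: (@cvge_le _ \oo _ _ (u ^~ U)) (nucvg _ mU).
by apply: nearW => n; have /finmeas_leP := uy n; exact.
Unshelve. all: by end_near. Qed.


Let norm mu : R := fine (mu setT).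

Let norm_ge0 mu : (0 <= norm mu)%R. Proof. exact: fine_ge0. Qed.

Let normZ (a : {nonneg R}) mu : (norm (a *: mu) = a%:num * norm mu)%R.
Proof. by rewrite /norm finmeasZE// fineM// fin_num_measure. Qed.

Let norm0_eq0 mu : (norm mu = 0 -> mu = 0)%R.
Proof.
move=> /eqP; rewrite fine_eq0 ?fin_num_measure// => /eqP muT.
apply: finmeas_ext => U mU; rewrite finmeas0E//; apply/eqP.
by rewrite -measure_le0 -muT; apply: le_measure; rewrite ?inE.
Qed.

Let normDE mu nu : (norm (mu + nu) = norm mu + norm nu)%R.
Proof. by rewrite /norm finmeasDE// fineD// fin_num_measure. Qed.

Let normD mu nu : (norm (mu + nu) <= norm mu + norm nu)%R.
Proof. by rewrite normDE. Qed.

Let norm_mono mu nu : (norm mu <= norm (mu + nu))%R.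
Proof. by rewrite normDE lerDl. Qed.

Let complete (u : nat -> finmeas R T) : cone_increasing u ->
  (forall n, norm (u n) <= 1)%R -> exists2 x, cone_lub u x & (norm x <= 1)%R.
Proof.
move=> uinc u1.
have uT n : u n setT <= 1%:E.
  by rewrite -[u n setT]fineK ?fin_num_measure// lee_fin; exact: u1.
have [|x ux xcvg] := finmeas_lub uinc; first by exists 1%R.
exists x => //; rewrite /norm -lee_fin fineK ?fin_num_measure//.
by apply: (@cvge_le _ \oo _ _ (u ^~ setT)); [apply: nearW|exact: xcvg].
Qed.

HB.instance Definition _ := isCone.Build R (finmeas R T)
  norm_ge0 normZ norm0_eq0 normD norm_mono complete.

Lemma finmeas_normE mu : (cone_norm mu)%:E = mu setT.
Proof. by rewrite fineK// fin_num_measure. Qed.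

Lemma finmeas_eval_linear U : measurable U ->
  cone_linear (fun mu => finmeas_eval mu U : {nonneg R}^o).
Proof.
move=> mU; split=> [mu nu|a mu]; apply/val_inj => /=.
  by rewrite finmeasDE// fineD// fin_num_measure.
by rewrite finmeasZE// fineM// fin_num_measure.
Qed.

Lemma finmeas_eval_continuous U : measurable U ->
  cone_continuous (fun mu => finmeas_eval mu U : {nonneg R}^o).
Proof.
move=> mU; split=> [mu nu /finmeas_leP munu|u uinc [M uM] x ux].
  by apply/nonneg_cone_leP; rewrite -lee_fin !finmeas_evalE// munu.
have [|y uy ycvg] := finmeas_lub uinc.
  by exists M => n; rewrite -finmeas_normE lee_fin.
rewrite (cone_lub_unique ux uy); apply/nonneg_cone_lubP; split=> [n|z uz].
  by rewrite -lee_fin !finmeas_evalE//; case: uy => /(_ n)/finmeas_leP + _; exact.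
rewrite -lee_fin finmeas_evalE//.
apply: (@cvge_le _ \oo _ _ (u ^~ U)); [apply: nearW => n|exact: ycvg].
by rewrite -finmeas_evalE// lee_fin; exact: uz.
Qed.

Lemma finmeas_eval_le_norm mu U : measurable U ->
  ((finmeas_eval mu U)%:num <= cone_norm mu)%R.
Proof.
move=> mU; rewrite -lee_fin finmeas_normE finmeas_evalE//.
by apply: le_measure; rewrite ?inE.
Qed.

Lemma finmeas_eval_opnorm U : measurable U -> U !=set0 ->
  cone_opnorm (fun mu => finmeas_eval mu U : {nonneg R}^o) = 1.
Proof.
move=> mU [r Ur]; apply/eqP; rewrite eq_le; apply/andP; split.
  apply: ub_ereal_sup => _ /= [mu mu1 <-]; rewrite lee_fin.
  exact: le_trans (finmeas_eval_le_norm mu mU) mu1.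
apply: ereal_sup_ubound; exists (finmeas_dirac r) => /=.
  rewrite -lee_fin finmeas_normE finmeas_diracE//.
  by rewrite diracE mem_set.
by rewrite finmeas_evalE// finmeas_diracE// diracE mem_set.
Qed.

Lemma finmeas_eval_neq0 U : measurable U ->
  (fun mu => finmeas_eval mu U : {nonneg R}^o) <> cst 0%R <-> U !=set0.
Proof.
move=> mU; split=> [U0|[r Ur]].
  apply/set0P/eqP => U0'; apply: U0; apply/funext => mu; apply/val_inj.
  by rewrite /= U0' measure0.
move=> /(congr1 (@^~ (finmeas_dirac r)))/(congr1 (fun z : {nonneg R} => z%:num%:E)).
rewrite finmeas_evalE// finmeas_diracE// diracE mem_set//= => /eqP.
by rewrite eqe oner_eq0.
Qed.

End finmeas_module.

Section finmeas_measurable_cone.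
Context (R : realType) (Ar : arCat) d (T : measurableType d).

Let tests (X : Ar) : set (cone_test R (finmeas R T) X) :=
  [set m | exists2 U, measurable U & m = fun _ mu => finmeas_eval mu U].

Let tests_dual X m : @tests X m -> forall r, cone_dual (m r).
Proof.
move=> [U mU ->] r; split; first exact: finmeas_eval_linear.
exact: finmeas_eval_continuous.
Qed.

Let tests_measurable X m : @tests X m -> forall x, cone_norm x <= 1 ->
  measurable_fun setT (fun r => (m r x)%:num) /\ forall r, (m r x)%:num <= 1.
Proof.
move=> [U mU ->] x x1; split=> [|r]; first exact: measurable_cst.
exact: le_trans (finmeas_eval_le_norm x mU) x1.
Qed.

Let tests_comp (X Y : Ar) (phi : ar_space Y -> ar_space X) :
  measurable_fun setT phi ->
  forall m, tests m -> tests (fun s => m (phi s)).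
Proof. by move=> _ m [U mU ->]; exists U. Qed.

Let tests_separate (x1 x2 : finmeas R T) :
  (forall m, @tests (ar_one Ar) m -> m (ar_pt Ar) x1 = m (ar_pt Ar) x2) -> x1 = x2.
Proof.
move=> x12; apply: finmeas_ext => U mU; rewrite -!finmeas_evalE//.
by congr (_%:num%:E); exact: x12 _ (ex_intro2 _ _ U mU erefl).
Qed.

Let tests_norm (x : finmeas R T) : cone_norm x =
  sup [set (m (ar_pt Ar) x)%:num / fine (cone_opnorm (m (ar_pt Ar))) | m in
       [set m | @tests (ar_one Ar) m /\ m (ar_pt Ar) <> cst 0]].
Proof.
set A := (X in sup X).
have Ax : ubound A (cone_norm x).
  move=> _ [m [[U mU ->] /(finmeas_eval_neq0 R mU) U0] <-].
  by rewrite finmeas_eval_opnorm //= divr1; exact: finmeas_eval_le_norm.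
have T0 : [set: T] !=set0 by exists point.
have xA : A (cone_norm x).
  exists (fun _ mu => finmeas_eval mu setT).
    by split; [exists setT|exact/(finmeas_eval_neq0 R measurableT)].
  by rewrite finmeas_eval_opnorm//= divr1.
apply/eqP; rewrite eq_le; apply/andP; split.
  by apply: ub_le_sup => //; exists (cone_norm x).
by apply: ge_sup => //; exists (cone_norm x).
Qed.

HB.instance Definition _ := isMeasurableCone.Build R Ar (finmeas R T)
  tests_dual tests_measurable tests_comp
  tests_separate tests_norm.

End finmeas_measurable_cone.

Section finmeas_integral.
Context (R : realType) dX (X : measurableType dX) d (T : measurableType d).
Variables (mu : {finite_measure set X -> \bar R}) (gamma : X -> finmeas R T).
Hypothesis mgamma : forall U, measurable U -> measurable_fun setT (gamma ^~ U).
Hypothesis bgamma : exists M, forall r, cone_norm (gamma r) <= M.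
Local Open Scope ereal_scope.

Definition mint & (forall U, measurable U -> measurable_fun setT (gamma ^~ U)) :=
  fun U : set T => \int[mu]_r gamma r U.

Local Notation nu := (mint mgamma).

Let mint0 : nu set0 = 0.
Proof. by rewrite /mint; under eq_integral do rewrite measure0; rewrite integral0. Qed.

Let mint_ge0 U : 0 <= nu U.
Proof. exact: integral_ge0. Qed.

Let mint_sigma_additive : semi_sigma_additive nu.
Proof.
move=> F mF tF mUF.
have -> : nu (\bigcup_n F n) = \sum_(0 <= n <oo) nu (F n).
  rewrite /mint -integral_nneseries//; last by move=> n; exact: mgamma.
  by apply: eq_integral => r _; rewrite measure_semi_bigcup.
by apply: is_cvg_nneseries.
Qed.

HB.instance Definition _ := isMeasure.Build _ _ _ nu
  mint0 mint_ge0 mint_sigma_additive.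

Lemma mint_fin : fin_num_fun nu.
Proof.
have [M gM] := bgamma.
have M0 : (0 <= M)%R by exact: le_trans (cone_norm_ge0 _) (gM point).
move=> U mU; rewrite ge0_fin_numE//.
apply: (@le_lt_trans _ _ (\int[mu]_r (cst M%:E) r)).
  apply: ge0_le_integral => //; first exact: mgamma.
  move=> r _; apply: (@le_trans _ _ (gamma r setT)).
    by apply: le_measure; rewrite ?inE.
  by rewrite -finmeas_normE lee_fin.
rewrite integral_cst//.
by rewrite lte_mul_pinfty// -ge0_fin_numE// fin_num_measure.
Qed.

End finmeas_integral.

Section finmeas_integrable_cone.
Context (R : realType) (Ar : arCat) d (T : measurableType d).

Let integrable (X : Ar) (gamma : ar_space X -> finmeas R T) :
  @cone_path R Ar _ X gamma ->
  forall mu : {finite_measure set (ar_space X) -> \bar R},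
  exists x, @cone_integral R Ar _ X gamma mu x.
Proof.
move=> [gM mg] mu.
have mgamma U : measurable U -> measurable_fun setT (gamma ^~ U).
  move=> mU.
  have := mg (ar_one Ar) _ (ex_intro2 _ _ U mU erefl).
  move=> /measurableT_comp /(_ (pair1_measurable (ar_pt Ar))) /= mf.
  under eq_fun do rewrite -finmeas_evalE//.
  exact/measurable_EFinP.
pose x := finmeas_of (mint mu mgamma) (mint_fin mu mgamma gM).
exists x => _ [U mU ->].
transitivity (x U); first exact: finmeas_evalE.
rewrite [LHS]finmeas_ofE//; apply: eq_integral => r _.
exact/esym/finmeas_evalE.
Qed.

HB.instance Definition _ := isIntegrableCone.Build R Ar (finmeas R T) integrable.

End finmeas_integrable_cone.

Definition Meas (R : realType) (Ar : arCat) (X : Ar) : iconeType R Ar :=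
  finmeas R (ar_space X).

(* Main.v *)
Require Import Defs.
From mathcomp Require Import all_boot all_order all_algebra.
From mathcomp Require Import all_classical all_reals all_analysis.
From mathcomp Require Import measurable_realfun.

(** Dirac measures form a measurable path whose integral against a finite
    measure [mu] is [mu] itself.  A morphism preserves this integral, so its
    value at [mu] is determined by its values on the Dirac measures. *)

Local Open Scope classical_set_scope.
Local Open Scope ring_scope.

Lemma finmeas_eval_dirac (R : realType) d (T : measurableType d) (U : set T)
    (r : T) :
  measurable U -> (finmeas_eval (finmeas_dirac r) U)%:num = \1_U r :> R.
Proof.
move=> mU; apply: EFin_inj.
by rewrite finmeas_evalE// finmeas_diracE.
Qed.

(** Dirac measures have norm 1, and the test at [U] turns the path into the indicator of [U] after
    the second projection. *)
Lemma cone_path_dirac (R : realType) (Ar : arCat) (X : Ar) :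
  cone_path (finmeas_dirac : ar_space X -> Meas R X).
Proof.
split=> [|Y _ [U mU ->]].
  exists 1 => r; rewrite -lee_fin finmeas_normE finmeas_diracE//.
  by rewrite diracT.
under eq_fun do rewrite finmeas_eval_dirac//.
exact: measurableT_comp (measurable_indic _) measurable_snd.
Qed.

(** Under the test at [U] the integrand becomes [\1_U], so both sides are [mu U]. *)
Lemma cone_integral_dirac (R : realType) (Ar : arCat) (X : Ar)
    (mu : Meas R X) :
  cone_integral (finmeas_dirac : ar_space X -> Meas R X) (finmeas_val mu) mu.
Proof.
move=> _ [U mU ->]; rewrite finmeas_evalE//.
under eq_integral do rewrite finmeas_eval_dirac//.
by rewrite integral_indic// setIT.
Qed.

Theorem theorem6p2 (R : realType) (Ar : arCat) (X : ar_obj Ar) (B : iconeType R Ar)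
    (f1 f2 : ICones (Meas R X) B) :
  (forall r : ar_space X, f1 (finmeas_dirac r) = f2 (finmeas_dirac r)) ->
  f1 = f2.
Proof.
(* Tests of [B] over the one-point space separate points, which leaves an equality of real
   numbers. *)
move=> f12; apply: icone_ext => mu; apply: cone_tests_separate => m mB.
have int (f : ICones (Meas R X) B) :=
  icone_integral (icone_funP f)
    (cone_path_dirac R Ar X) (cone_integral_dirac R Ar X mu).
(* Each side becomes the integral over [mu] of [m] at the images of the Dirac measures. *)
apply/val_inj/EFin_inj; rewrite (int f1 _ mB) (int f2 _ mB).
by apply: eq_integral => r _ /=; rewrite f12.
Qed.
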